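(* Let $K$ be a field of characteristic zero and let $F(i,j)$ be a bivariate hypergeometric term over $K$, i.e. $F(i+1,j)/F(i,j)$ and $F(i,j+1)/F(i,j)$ are rational functions of $i,j$. Write $$\frac{F(i+1,j)}{F(i,j)}=\frac{r_1(i,j)}{s_1(i,j)},\qquad \frac{F(i,j+1)}{F(i,j)}=\frac{r_2(i,j)}{s_2(i,j)},$$ with $r_1,s_1\in K[i,j]$ relatively prime and $r_2,s_2\in K[i,j]$ relatively prime. Suppose $R_1=f_1/g_1$ and $R_2=f_2/g_2$ are rational functions, with $f_1,g_1\in K[i,j]$ relatively prime and $f_2,g_2\in K[i,j]$ relatively prime, such that $$F(i,j)=\Delta_i\big(R_1(i,j)F(i,j)\big)+\Delta_j\big(R_2(i,j)F(i,j)\big).$$ Let $u=\gcd(s_1,s_2)$, $v=\gcd(g_1,g_2)$, $s_1'=s_1/u$, $s_2'=s_2/u$, $g_1'=g_1/v$, $g_2'=g_2/v$. Assume: (H1) for each $k\in\{1,2\}$: if $p(i,j)$ and $p(i+h_1,j+h_2)$ are both irreducible factors of $g_k(i,j)$ for some $h_1,h_2\in\{-1,0,1\}$, then $p(i+h_1,j+h_2)=p(i,j)$ (up to a nonzero constant factor); (H2) $\gcd(g_1',v)=\gcd(g_2',v)=1$; (H3) for all $h_1,h_2\in\{-1,0,1\}$, $\gcd\big(g_1'(i+h_1,j+h_2),g_2'(i,j)\big)=1$. Then there exist polynomials $v_1(i)$, $w_1(i)$ in $i$ alone, $v_2(j)$, $u_1(j)$ in $j$ alone, $v_3(t)$ in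 one variable, and $v_4(i,j),u_2(i,j),w_2(i,j)$ such that $$g_1(i,j)=v_1(i)\,v_2(j)\,v_3(i+j)\,v_4(i,j)\,u_1(j)\,u_2(i,j),\qquad g_2(i,j)=v_1(i)\,v_2(j)\,v_3(i+j)\,v_4(i,j)\,w_1(i)\,w_2(i,j),$$ and $v_1(i)\mid r_1(i-1,j)s_2'(i-1,j)$; $v_2(j)\mid r_2(i,j-1)s_1'(i,j-1)$; $v_4(i,j)\mid \gcd\big(r_1(i-1,j)s_2'(i-1,j),\ r_2(i,j-1)s_1'(i,j-1)\big)$; $u_2(i,j)\mid \gcd\big(s_1(i,j)s_2'(i,j),\ r_1(i-1,j)s_2'(i-1,j)\big)$; $w_2(i,j)\mid \gcd\big(s_2(i,j)s_1'(i,j),\ r_2(i,j-1)s_1'(i,j-1)\big)$.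
   Context: $\Delta_x$ denotes the forward difference operator in the variable $x$: $\Delta_x G = G|_{x\to x+1}-G$. For polynomials $a,b$, $\gcd(a,b)$ denotes their monic greatest common divisor. *)

(* Defs.v *)
From HB Require Import structures.
From mathcomp Require Import all_boot all_order all_algebra.
Set Implicit Arguments.
Unset Strict Implicit.
Unset Printing Implicit Defensive.
Import GRing.Theory.
Local Open Scope ring_scope.

(* K[i,j] is {poly {poly K}} with the conventions of polyXY: the outer
   indeterminate 'X is i and the inner one 'Y is j, so that p(i,j) is p.[i, j].
   Hence q(i) is q^:P, q(j) is q%:P and q(i+j) is poly_XaY q, for q : {poly K}. *)
Notation bipoly K := {poly {poly K}}.
Notation birat K := {fraction {poly {poly K}}}.
Notation "x %:F" := (@FracField.tofrac _ x) : ring_scope.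

Section BivariatePolynomials.
Variable K : fieldType.
Implicit Types (p q d e : bipoly K) (a b : int).

(* p(i + a, j + b) *)
Definition shift a b p : bipoly K :=
  map_poly (comp_poly ('X + (b%:~R)%:P)) p \Po ('X + (a%:~R)%:P).

Lemma horner2_shift a b p (x y : K) :
  (shift a b p).[x, y] = p.[x + a%:~R, y + b%:~R].
Proof.
rewrite /shift horner_comp.
have -> : ('X + (a%:~R)%:P : bipoly K).[x%:P] = (x + a%:~R)%:P.
  by rewrite hornerD hornerX hornerC polyCD rmorph_int.
elim/poly_ind: p => [|p c IHp]; first by rewrite map_poly0 !horner0.
rewrite rmorphD rmorphM /= map_polyX map_polyC /= !hornerE IHp /=.
by rewrite horner_comp !hornerE.
Qed.

(* The library's [p %| q] is pseudo-divisibility when the coefficients are not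
   a field: for bivariate polynomials it is divisibility over K(j)[i] only.
   Likewise for [gcdp], [coprimep] and [irreducible_poly]. *)
Definition divides p q : Prop := exists c, q = c * p.

(* "Monic" means that the leading coefficient for the lexicographic order with
   i > j is 1. *)
Definition is_gcd p q d : Prop :=
  [/\ lead_coef (lead_coef d) = 1, divides d p, divides d q
    & forall e, divides e p -> divides e q -> divides e d].

Definition coprime2 p q : Prop := is_gcd p q 1.

Definition irreducible2 p : Prop :=
  [/\ p != 0, p \isn't a GRing.unit
    & forall d e, p = d * e -> d \is a GRing.unit \/ e \is a GRing.unit].

Definition irreducible_factor p q : Prop := irreducible2 p /\ divides p q.

Definition eq_upto_const p q : Prop :=
  exists2 c : K, c != 0 & p = c%:P%:P * q.

End BivariatePolynomials.

Section HypergeometricTerms.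
Variables (K : fieldType) (A : comAlgType (birat K)).

(* Hypergeometric terms live in an arbitrary difference ring extension A of
   K(i,j): Ei and Ej are the substitutions i -> i+1 and j -> j+1 on A. Being
   ring morphisms, they are determined on K(i,j) by their values on K[i,j]. *)
Definition shift_operators (Ei Ej : {rmorphism A -> A}) : Prop :=
  [/\ injective Ei, injective Ej, forall G, Ei (Ej G) = Ej (Ei G),
      forall p : bipoly K, Ei p%:F%:A = (shift 1 0 p)%:F%:A
    & forall p : bipoly K, Ej p%:F%:A = (shift 0 1 p)%:F%:A].

(* F need not be invertible in A, so that the quotient E F / F is c is written
   E F = c F; since F is nonzero and K(i,j) is a field, c is unique, and c is
   nonzero when E is injective. *)
Definition shift_quotient (E : {rmorphism A -> A}) (F : A) (c : birat K) :
  Prop := E F = c *: F.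

Definition hypergeometric (Ei Ej : {rmorphism A -> A}) (F : A) : Prop :=
  [/\ F != 0, exists c, shift_quotient Ei F c & exists c, shift_quotient Ej F c].

Definition Delta (E : {rmorphism A -> A}) (G : A) : A := E G - G.

End HypergeometricTerms.

(* Main.v *)
Require Import Defs.
From HB Require Import structures.
From mathcomp Require Import all_boot all_order all_algebra.
From mathcomp Require Import ring.
From Stdlib Require Import Classical.
Import GRing.Theory.
Local Open Scope ring_scope.

Set Implicit Arguments.
Unset Strict Implicit.

(* Dividing the telescoping equation by F and clearing denominators gives an
   identity in K[i,j], a unique factorization domain. Modulo g1(i+1,j), only the
   term containing f1(i+1,j) r1 s2' g1 g2 g2(i,j+1) survives in it. So if
   an irreducible power p^m divides g1, and p(i+1,j) divides none of g1, g2 and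
   g2(i,j+1), then p(i+1,j)^m divides r1 s2'. By (H1)-(H3), those
   three divisibilities can only hold if p(i+1,j) = p, i.e. p is in K[j], or if
   p divides both g1 and g2 and p(i+1,j-1) = p, i.e. p is in K[i+j]. Modulo g1 one
   obtains in the same way that p^m divides s1 s2', and exchanging i and j gives
   the conditions on g2. It remains to split off from gcd(g1,g2), g1' and g2'
   their largest divisors that depend on i, on j or on i+j alone. *)

(** * Divisibility and unique factorization in an integral domain *)

Section Divisibility.
Variable R : idomainType.
Implicit Types a b c p x y : R.

(** Kept general because factoriality is proved for K, K[j] and K[i,j] in turn. At [bipoly K], this
    and [irreducible_elt] unfold to [divides] and [irreducible2]. *)
Definition dvd a b : Prop := exists c, b = c * a.

Definition irreducible_elt p : Prop :=
  [/\ p != 0, p \isn't a GRing.unit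
    & forall d e, p = d * e -> d \is a GRing.unit \/ e \is a GRing.unit].

Lemma dvd_refl a : dvd a a.
Proof. by exists 1; rewrite mul1r. Qed.

Lemma dvd_trans b a c : dvd a b -> dvd b c -> dvd a c.
Proof. by move=> [x ->] [y ->]; exists (y * x); rewrite mulrA. Qed.

Lemma dvd_mull c a b : dvd a b -> dvd a (c * b).
Proof. by move=> [x ->]; exists (c * x); rewrite mulrA. Qed.

Lemma dvd_mulr c a b : dvd a b -> dvd a (b * c).
Proof. by rewrite mulrC; apply: dvd_mull. Qed.

Lemma dvd_add a b c : dvd a b -> dvd a c -> dvd a (b + c).
Proof. by move=> [x ->] [y ->]; exists (x + y); rewrite mulrDl. Qed.

Lemma dvd_addKl a b c : dvd a b -> dvd a (b + c) -> dvd a c.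
Proof.
move=> [x ->] [y e]; exists (y - x).
by rewrite mulrBl -e addrAC subrr add0r.
Qed.

Lemma dvd_mul2l c a b : c != 0 -> dvd (c * a) (c * b) -> dvd a b.
Proof.
move=> c0 [x e]; exists x; apply: (mulfI c0); rewrite e; ring.
Qed.

Lemma dvd_mul_both a b c d : dvd a b -> dvd c d -> dvd (a * c) (b * d).
Proof. by move=> [x ->] [y ->]; exists (x * y); ring. Qed.

Lemma dvd_expn m a b : (0 < m)%N -> dvd (a ^+ m) b -> dvd a b.
Proof.
by case: m => // m _; apply: dvd_trans; rewrite exprSr; apply: dvd_mull (dvd_refl a).
Qed.

Lemma unit_dvd a b : a \is a GRing.unit -> dvd a b.
Proof. by move=> Ua; exists (b * a^-1); rewrite mulrVK. Qed.

Lemma dvd_unit a b : dvd a b -> b \is a GRing.unit -> a \is a GRing.unit.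
Proof. by move=> [c ->]; rewrite unitrM => /andP[]. Qed.

Lemma dvd_neq0 a b : dvd a b -> b != 0 -> a != 0.
Proof. by move=> [c ->]; rewrite mulf_eq0 negb_or => /andP[]. Qed.

(* [mu] is an additive size, which makes factorization terminate. *)
Definition factorial_by (mu : R -> nat) : Prop :=
  [/\ forall a b, a != 0 -> b != 0 -> mu (a * b) = (mu a + mu b)%N,
      forall a, a != 0 -> mu a = 0%N -> a \is a GRing.unit
    & forall p a b, irreducible_elt p -> dvd p (a * b) -> dvd p a \/ dvd p b].

Section Factorial.
Variable mu : R -> nat.
Hypothesis facR : factorial_by mu.

Lemma mu_eq0 a : a != 0 -> (mu a == 0%N) = (a \is a GRing.unit).
Proof.
case: facR => muM mu0 _ a0; apply/idP/idP => [/eqP/(mu0 _ a0) //|Ua].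
(* Additivity forces mu 1 = 0, so mu a + mu a^-1 = 0 for a unit a. *)
have := muM 1 1 (oner_neq0 _) (oner_neq0 _); rewrite mulr1 => /eqP.
rewrite -{1}[mu 1]addn0 eqn_add2l => /eqP mu1.
have := muM a a^-1 a0 (invr_neq0 a0); rewrite divrr // -mu1 => /esym/eqP.
by rewrite addn_eq0 => /andP[].
Qed.

Lemma mu_ltn a b : a != 0 -> b != 0 -> a \isn't a GRing.unit ->
  (mu b < mu (b * a))%N.
Proof.
move=> a0 b0; rewrite -mu_eq0 // -lt0n => lt0.
by case: facR => -> // _ _; rewrite -addn1 leq_add2l.
Qed.

Lemma irreducible_divisor a : a != 0 -> a \isn't a GRing.unit ->
  exists2 p, irreducible_elt p & dvd p a.
Proof.
have [n] := ubnP (mu a); elim: n a => // n IHn a; rewrite ltnS => le_a a0 Ua.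
have [irr|] := classic (irreducible_elt a); first by exists a; last exact: dvd_refl.
move=> Nirr; suff [d [e [e_a Ud Ue]]] : exists d e,
    [/\ a = d * e, d \isn't a GRing.unit & e \isn't a GRing.unit].
  move: a0; rewrite e_a mulf_eq0 negb_or => /andP[d0 e0].
  have [|//|//|p irr_p p_d] := IHn d.
    by apply: leq_trans le_a; rewrite e_a mu_ltn.
  by exists p => //; apply: dvd_mulr.
apply: NNPP => H; apply: Nirr; split=> // d e e_a.
have [|Ud] := boolP (d \is a GRing.unit); first by left.
have [|Ue] := boolP (e \is a GRing.unit); first by right.
by case: H; exists d, e.
Qed.

(** Since p is prime and does not divide a, it divides b; one factor p is cancelled on both sides
    and the argument repeated. *)
Lemma prime_expn_coprime p m a b : irreducible_elt p -> ~ dvd p a ->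
  dvd (p ^+ m) (a * b) -> dvd (p ^+ m) b.
Proof.
move=> irr_p Npa; have [p0 _ _] := irr_p; have [_ _ prime_p] := facR.
elim: m b => [|m IHm] b; first by move=> _; apply: unit_dvd; rewrite expr0 unitr1.
move=> p_ab; have [//|[b' e_b]] : dvd p a \/ dvd p b.
  by apply: prime_p irr_p _; apply: dvd_trans p_ab; exists (p ^+ m); rewrite exprSr.
rewrite e_b exprS mulrC; apply: dvd_mul_both (dvd_refl _).
apply: IHm; apply: (dvd_mul2l p0); rewrite -exprS.
by have -> : p * (a * b') = a * b by rewrite e_b; ring.
Qed.

(** Reduces the divisibilities of the theorem to prime powers. The induction cancels an irreducible
    p common to x and y. *)
Lemma dvd_prime_powers x y : x != 0 ->
  (forall p m, irreducible_elt p -> (0 < m)%N -> dvd (p ^+ m) x ->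
     dvd (p ^+ m) y) -> dvd x y.
Proof.
have [n] := ubnP (mu x); elim: n x y => // n IHn x y; rewrite ltnS => le_x x0 H.
have [Ux|Ux] := boolP (x \is a GRing.unit); first exact: unit_dvd.
have [p irr_p [x' e_x]] := irreducible_divisor x0 Ux.
have [p0 Up irrp] := irr_p.
have [|y' e_y] := H p 1%N irr_p isT; first by rewrite expr1; exists x'.
rewrite expr1 in e_y.
have x'0 : x' != 0 by apply: contraNneq x0 => x'0; rewrite e_x x'0 mul0r.
rewrite e_x e_y; apply: dvd_mul_both (dvd_refl _).
apply: IHn => // [|q m irr_q m_gt0 q_x'].
  by apply: leq_trans le_x; rewrite e_x mu_ltn.
have [q_p|Nqp] := classic (dvd q p).
- case: q_p => k e_p; have [_ Uq _] := irr_q.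
  have [Uk|] := irrp _ _ e_p; last by rewrite (negPf Uq).
  have q0 : q != 0 by case: irr_q.
  have q_y : dvd (q ^+ m.+1) y.
    apply: H => //; rewrite e_x e_p exprSr mulrA.
    by apply: dvd_mul_both (dvd_refl _); apply: dvd_mulr.
  move: q_y; rewrite e_y e_p exprS.
  have -> : y' * (k * q) = q * (k * y') by ring.
  move/(dvd_mul2l q0) => [t e_t]; exists (k^-1 * t).
  by rewrite -mulrA -e_t mulrA mulVr // mul1r.
- apply: (prime_expn_coprime irr_q Nqp); rewrite mulrC -e_y.
  by apply: H => //; rewrite e_x; apply: dvd_mulr.
Qed.

(** Nonunit divisors satisfying P are removed one after another; [mu] drops each time, so the
    process ends with a cofactor that has none left. *)
Lemma split_off (P : R -> Prop) x : x != 0 -> P 1 ->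
  (forall a b, P a -> P b -> P (a * b)) ->
  exists a b, [/\ x = a * b, P a
    & forall c, dvd c b -> P c -> c \is a GRing.unit].
Proof.
move=> + P1 PM.
have [n] := ubnP (mu x); elim: n x => // n IHn x; rewrite ltnS => le_x x0.
have [[c [[x' e_x] Pc Uc]]|H] := classic (exists c, [/\ dvd c x, P c & c \isn't a GRing.unit]).
  have c0 : c != 0 by apply: contraNneq x0 => c0; rewrite e_x c0 mulr0.
  have x'0 : x' != 0 by apply: contraNneq x0 => x'0; rewrite e_x x'0 mul0r.
  have [||a [b [e_x' Pa Hb]]] := IHn x' => //.
    by apply: leq_trans le_x; rewrite e_x mu_ltn.
  by exists (a * c), b; split=> //; [rewrite e_x e_x'; ring|apply: PM].
exists 1, x; split=> // [|c c_x Pc]; first by rewrite mul1r.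
by apply/negPn/negP => Uc; apply: H; exists c.
Qed.

(** Common irreducible factors are collected until none remains; then every common divisor is a
    unit. *)
Lemma gcd_exists a b : a != 0 -> exists d,
  [/\ dvd d a, dvd d b & forall e, dvd e a -> dvd e b -> dvd e d].
Proof.
have [n] := ubnP (mu a); elim: n a b => // n IHn a b; rewrite ltnS => le_a a0.
have [[p [irr_p [a' e_a] [b' e_b]]]|H] := classic
    (exists p, [/\ irreducible_elt p, dvd p a & dvd p b]).
  have [p0 Up _] := irr_p; have [_ _ prime_p] := facR.
  have a'0 : a' != 0 by apply: contraNneq a0 => a'0; rewrite e_a a'0 mul0r.
  have [||d [da' db' Hd]] := IHn a' b' => //.
    by apply: leq_trans le_a; rewrite e_a mu_ltn.
  exists (d * p); rewrite e_a e_b.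
  split; [exact: dvd_mul_both (dvd_refl _)|exact: dvd_mul_both (dvd_refl _)|].
  (* If p divides e, cancel p throughout. Otherwise p divides the cofactor of e, so e already
     divides a' and b'. *)
  move=> e e_a'p e_b'p; have [[e' e_e]|Npe] := classic (dvd p e).
    rewrite e_e in e_a'p e_b'p *; apply: dvd_mul_both (dvd_refl _).
    by apply: Hd; apply: (dvd_mul2l p0); rewrite ![p * _]mulrC.
  have cancel t : dvd e (t * p) -> dvd e t.
    move=> [k e_k]; have [|[k' e_k']|//] := prime_p p k e irr_p.
      by rewrite -e_k; exists t.
    by exists k'; apply: (mulIf p0); rewrite e_k e_k'; ring.
  by apply: dvd_mulr; apply: Hd; apply: cancel.
exists 1; split=> [||e ea eb]; try exact: unit_dvd (unitr1 _).
have e0 := dvd_neq0 ea a0.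
apply: unit_dvd; apply/negPn/negP => Ue.
have [p irr_p pe] := irreducible_divisor e0 Ue.
by apply: H; exists p; split=> //; apply: dvd_trans pe _.
Qed.

End Factorial.
End Divisibility.

(** * Gauss's lemma: polynomials over a factorial domain form a factorial domain *)

Section PolyFactorial.
Variables (R : idomainType) (mu : R -> nat).
Hypothesis facR : factorial_by mu.
Implicit Types (a b p q d t : {poly R}) (c k : R).

(** Evaluation at 0 shows that the cofactor of c vanishes there, hence is a multiple of 'X. *)
Lemma dvd_polyC_mulX c t : c != 0 -> dvd c%:P (t * 'X) -> dvd c%:P t.
Proof.
move=> c0 [k e_k]; have k0 : root k 0.
  have := congr1 (horner^~ 0) e_k; rewrite !hornerE => /esym/eqP.
  by rewrite mulf_eq0 (negPf c0) orbF.
have [k' e_k'] := factor_theorem k 0 k0; exists k'.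
apply: (mulIf (negbT (polyX_eq0 R))); rewrite e_k e_k' subr0; ring.
Qed.

(** The constant terms multiply to a multiple of c, so c divides one of them; that term is
    subtracted, 'X is cancelled, and induction applies to the shorter polynomial. *)
Lemma polyC_prime c a b : irreducible_elt c ->
  dvd c%:P (a * b) -> dvd c%:P a \/ dvd c%:P b.
Proof.
move=> irr_c; have [c0 _ _] := irr_c; have [_ _ prime_c] := facR.
elim/poly_ind: a b => [|a a0 IHa] b; first by left; exists 0; rewrite mul0r.
elim/poly_ind: b => [|b b0 IHb]; first by right; exists 0; rewrite mul0r.
move=> c_ab; have : dvd c (a0 * b0).
  have [k e_k] := c_ab; exists k.[0].
  by have := congr1 (horner^~ 0) e_k; rewrite !hornerE.
case/(prime_c _ _ _ irr_c) => -[k e_k].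
- have c_a0 : dvd c%:P a0%:P by exists k%:P; rewrite e_k polyCM.
  have : dvd c%:P (a * (b * 'X + b0%:P)).
    apply: (dvd_polyC_mulX c0); apply: (dvd_addKl (b := a0%:P * (b * 'X + b0%:P))).
      exact: dvd_mulr.
    by move: c_ab; congr dvd; ring.
  case/IHa => [c_a|]; last by right.
  by left; apply: dvd_add c_a0; apply: dvd_mulr.
- have c_b0 : dvd c%:P b0%:P by exists k%:P; rewrite e_k polyCM.
  have : dvd c%:P ((a * 'X + a0%:P) * b).
    apply: (dvd_polyC_mulX c0); apply: (dvd_addKl (b := (a * 'X + a0%:P) * b0%:P)).
      exact: dvd_mull.
    by move: c_ab; congr dvd; ring.
  case/IHb => [|c_b]; first by left.
  by right; apply: dvd_add c_b0; apply: dvd_mulr.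
Qed.

(** The irreducible factors of c are cancelled one by one: none divides the primitive p, so each
    divides t by [polyC_prime]. *)
Lemma Gauss_dvd c b p t : c != 0 ->
  (forall k, irreducible_elt k -> ~ dvd k%:P p) ->
  c%:P * b = p * t -> dvd p b.
Proof.
move=> + prim_p; have [n] := ubnP (mu c).
elim: n c t => // n IHn c t; rewrite ltnS => le_c c0 e_b.
have [Uc|Uc] := boolP (c \is a GRing.unit).
  exists (c^-1%:P * t); have -> : b = c^-1%:P * (c%:P * b).
    by rewrite mulrA -polyCM mulVr // mul1r.
  by rewrite e_b; ring.
have [k irr_k [c' e_c]] := irreducible_divisor facR c0 Uc.
have [k0 Uk _] := irr_k.
have c'0 : c' != 0 by apply: contraNneq c0 => c'0; rewrite e_c c'0 mul0r.
have [|kp|[t' e_t]] := polyC_prime (a := p) (b := t) irr_k.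
- by rewrite -e_b e_c polyCM; exists (c'%:P * b); ring.
- by case: (prim_p k).
apply: (IHn c' t') => //; first by apply: leq_trans le_c; rewrite e_c (mu_ltn facR).
have k0P : k%:P != 0 by rewrite polyC_eq0.
by apply: (mulIf k0P); rewrite -!mulrA -e_t -e_b e_c polyCM; ring.
Qed.

(** A factorization over the fraction field descends to R with the same degrees: each irreducible
    factor of the denominator c divides q or d and is cancelled there. *)
Lemma Gauss_factor c p q d : c != 0 -> c%:P * p = q * d ->
  exists q' d', [/\ p = q' * d', size q' = size q & size d' = size d].
Proof.
have [n] := ubnP (mu c).
elim: n c q d => // n IHn c q d; rewrite ltnS => le_c c0 e_p.
have [Uc|Uc] := boolP (c \is a GRing.unit).
  exists (c^-1%:P * q), d; split=> //.
    have -> : p = c^-1%:P * (c%:P * p) by rewrite mulrA -polyCM mulVr // mul1r.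
    by rewrite e_p mulrA.
  by rewrite size_Cmul // invr_eq0.
have [k irr_k [c' e_c]] := irreducible_divisor facR c0 Uc.
have [k0 Uk _] := irr_k.
have c'0 : c' != 0 by apply: contraNneq c0 => c'0; rewrite e_c c'0 mul0r.
have lt_c' : (mu c' < n)%N by apply: leq_trans le_c; rewrite e_c (mu_ltn facR).
have k0P : k%:P != 0 by rewrite polyC_eq0.
have [|[q' e_q]|[d' e_d]] := polyC_prime (a := q) (b := d) irr_k.
- by rewrite -e_p e_c polyCM; exists (c'%:P * p); ring.
- have [|p1 [p2 [-> sz1 sz2]]] := IHn c' q' d lt_c' c'0.
    by apply: (mulIf k0P); rewrite [q' * d * _]mulrAC -e_q -e_p e_c polyCM; ring.
  by exists p1, p2; rewrite sz1 sz2 e_q [q' * _]mulrC size_Cmul.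
- have [|p1 [p2 [-> sz1 sz2]]] := IHn c' q d' lt_c' c'0.
    by apply: (mulIf k0P); rewrite -!mulrA -e_d -e_p e_c polyCM; ring.
  by exists p1, p2; rewrite sz1 sz2 e_d [d' * _]mulrC size_Cmul.
Qed.

Lemma irreducible_polyC_prime p a b : irreducible_elt p -> size p = 1%N ->
  dvd p (a * b) -> dvd p a \/ dvd p b.
Proof.
move=> irr_p /eqP sz_p; have [p0 Up irrp] := irr_p.
case/size_poly1P: sz_p => c c0 e_p; rewrite e_p; apply: polyC_prime; split=> //.
  by move: Up; rewrite e_p poly_unitE size_polyC c0 coefC.
move=> d e e_c; have [|Ud|Ue] := irrp d%:P e%:P; first by rewrite e_p e_c polyCM.
  by left; move: Ud; rewrite poly_unitE coefC => /andP[].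
by right; move: Ue; rewrite poly_unitE coefC => /andP[].
Qed.

Lemma irreducible_primitive p k : irreducible_elt p -> (1 < size p)%N ->
  irreducible_elt k -> ~ dvd k%:P p.
Proof.
move=> [p0 _ irrp] sz_p [k0 Uk _] [q e_p]; case: (irrp _ _ e_p); rewrite poly_unitE.
  move=> /andP[/eqP sz_q _].
  by move: sz_p; rewrite e_p mulrC size_Cmul // sz_q.
by rewrite coefC eqxx (negPf Uk) andbF.
Qed.

(* The library's [gcdp p a] divides [p] up to a constant factor only; Gauss's lemma
   turns this into a factorization of [p]. One of its factors is thus constant,
   and then either [p] divides a multiple [c a], or Bezout applies. *)
Lemma irreducible_poly_prime p a b : irreducible_elt p ->
  dvd p (a * b) -> dvd p a \/ dvd p b.
Proof.
move=> irr_p; have [p0 Up irrp] := irr_p.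
have [sz_p|] := leqP (size p) 1.
  by apply: irreducible_polyC_prime => //; apply/eqP; rewrite eqn_leq sz_p size_poly_gt0.
move=> sz_p [t e_t].
have prim_p k := @irreducible_primitive p k irr_p sz_p.
have /Pdiv.Idomain.dvdpP[[c q] /= c0 e_p] := dvdp_gcdl p a.
have /Pdiv.Idomain.dvdpP[[c1 q1] /= c10 e_a] := dvdp_gcdr p a.
have [[u v] /= /eqpP[[k1 k2] /= /andP[k10 k20] e_uv]] := Bezoutp p a.
set d := gcdp p a in e_p e_a e_uv.
rewrite -mul_polyC in e_p; rewrite -mul_polyC in e_a; rewrite -!mul_polyC in e_uv.
have [q' [d' [e_p' sz_q' sz_d']]] := Gauss_factor c0 e_p.
have [] := irrp _ _ e_p'; rewrite poly_unitE => /andP[/eqP sz1 _].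
- left; rewrite sz_q' in sz1; case/eqP/size_poly1P: sz1 => k k0 e_k.
  apply: (Gauss_dvd (c := k * c1) (t := c%:P * q1)); rewrite ?mulf_neq0 //.
  rewrite polyCM -mulrA e_a.
  have -> : p * (c%:P * q1) = q1 * (c%:P * p) by ring.
  by rewrite e_p e_k; ring.
- right; rewrite sz_d' in sz1; case/eqP/size_poly1P: sz1 => k k0 e_k.
  apply: (Gauss_dvd (c := k2 * k) (t := k1%:P * (u * b + v * t))); rewrite ?mulf_neq0 //.
  rewrite polyCM -e_k -e_uv.
  have -> : k1%:P * (u * p + v * a) * b = k1%:P * (u * p * b + v * (a * b)) by ring.
  by rewrite e_t; ring.
Qed.

(** The degree alone would vanish on nonunit constants; the leading coefficient accounts for them,
    and both terms are additive. *)
Definition poly_mu p := ((size p).-1 + mu (lead_coef p))%N.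

Lemma factorial_poly : factorial_by poly_mu.
Proof.
have [muM mu0 _] := facR.
split; last exact: irreducible_poly_prime.
- move=> a b a0 b0; rewrite /poly_mu size_mul // lead_coefM muM ?lead_coef_eq0 //.
  move: a0 b0; rewrite -!size_poly_gt0.
  by case: (size a) => // m _; case: (size b) => // n _ /=; rewrite addnS /= addnACA.
- move=> a a0 /eqP; rewrite addn_eq0 => /andP[/eqP sz_a /eqP/mu0].
  rewrite lead_coef_eq0 => /(_ a0); rewrite poly_unitE lead_coefE sz_a => ->.
  by rewrite andbT; move: a0 sz_a; rewrite -size_poly_gt0; case: (size a) => // n _ /= ->.
Qed.

End PolyFactorial.

(** Size 0 works since every nonzero element is a unit, so that there are no irreducible
    elements. *)
Lemma factorial_field (K : fieldType) : factorial_by (fun _ : K => 0%N).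
Proof.
split=> // [a a0 _|p a b [p0]]; by rewrite unitfE // p0.
Qed.

(** * Shifts of bivariate polynomials, and the polynomials they fix *)

Section Shift.
Variable K : fieldType.
Implicit Types (p q : bipoly K) (a b c d : int).

HB.instance Definition _ a b := GRing.RMorphism.copy (@shift K a b)
  (comp_poly ('X + (a%:~R)%:P) \o map_poly (comp_poly ('X + (b%:~R)%:P))).

(** Reduces identities between shifts, [swapXY] and [shear] to a check on constants, i and j. *)
Lemma bipoly_rmorphism_ext (S : nzRingType) (f g : {rmorphism bipoly K -> S}) :
  (forall k : K, f k%:P%:P = g k%:P%:P) -> f 'X = g 'X -> f 'Y = g 'Y -> f =1 g.
Proof.
move=> fgC fgX fgY; elim/poly_ind => [|p c IHp]; first by rewrite !rmorph0.
rewrite !rmorphD !rmorphM /= IHp fgX; congr (_ + _).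
elim/poly_ind: c => [|c k IHc]; first by rewrite !rmorph0.
by rewrite polyCD polyCM !rmorphD !rmorphM /= IHc fgC fgY.
Qed.

Lemma shiftC a b (k : K) : shift a b k%:P%:P = k%:P%:P.
Proof. by rewrite /shift map_polyC /= comp_polyC comp_polyC. Qed.

Lemma shiftX a b : shift a b 'X = 'X + (a%:~R)%:P%:P :> bipoly K.
Proof. by rewrite /shift map_polyX comp_polyX !rmorph_int. Qed.

Lemma shiftY a b : shift a b 'Y = 'Y + (b%:~R)%:P%:P :> bipoly K.
Proof. by rewrite /shift map_polyC /= comp_polyX comp_polyC polyCD. Qed.

Lemma shift_comp a b c d p : shift a b (shift c d p) = shift (a + c) (b + d) p.
Proof.
apply: (bipoly_rmorphism_ext (f := shift a b \o shift c d)
  (g := shift (a + c) (b + d))) => [k||] /=.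
- by rewrite !shiftC.
- by rewrite !shiftX rmorphD /= shiftX shiftC rmorphD /= !polyCD addrA.
- by rewrite !shiftY rmorphD /= shiftY shiftC rmorphD /= !polyCD addrA.
Qed.

Lemma shift00 p : shift 0 0 p = p.
Proof. by rewrite /shift !addr0 comp_polyXr map_poly_id // => x _; apply: comp_polyXr. Qed.

Lemma shiftK a b : cancel (@shift K a b) (shift (- a) (- b)).
Proof. by move=> p; rewrite shift_comp !addNr shift00. Qed.

Lemma shiftVK a b : cancel (@shift K (- a) (- b)) (shift a b).
Proof. by move=> p; rewrite shift_comp !subrr shift00. Qed.

Lemma shift_dvd a b p q : dvd p q -> dvd (shift a b p) (shift a b q).
Proof. by move=> [c ->]; exists (shift a b c); rewrite rmorphM. Qed.

Lemma dvd_shiftr a b p q : dvd p (shift a b q) -> dvd (shift (- a) (- b) p) q.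
Proof. by move/(shift_dvd (- a) (- b)); rewrite shiftK. Qed.

Lemma shift_unit a b p : (shift a b p \is a GRing.unit) = (p \is a GRing.unit).
Proof.
apply/idP/idP => U; last exact: rmorph_unit.
by rewrite -(shiftK a b p); apply: rmorph_unit.
Qed.

Lemma shift_eq0 a b p : (shift a b p == 0) = (p == 0).
Proof. by rewrite -[RHS](inj_eq (can_inj (shiftK a b))) rmorph0. Qed.

Lemma irreducible_shift a b p : irreducible_elt p -> irreducible_elt (shift a b p).
Proof.
move=> [p0 Up irrp]; split; rewrite ?shift_eq0 ?shift_unit // => d e e_p.
have [|Ud|Ue] := irrp (shift (- a) (- b) d) (shift (- a) (- b) e).
- by rewrite -rmorphM /= -e_p shiftK.
- by left; rewrite shift_unit in Ud.
- by right; rewrite shift_unit in Ue.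
Qed.

Lemma lead_coef_shift a b p :
  lead_coef (lead_coef (shift a b p)) = lead_coef (lead_coef p).
Proof.
have lead_comp (S : idomainType) (x : S) (r : {poly S}) :
    lead_coef (r \Po ('X + x%:P)) = lead_coef r.
  by rewrite lead_coef_comp ?size_XaddC // lead_coefXaddC expr1n mulr1.
rewrite /shift lead_comp lead_coef_map_inj ?lead_comp ?rmorph0 //.
exact: can_inj (fun r => comp_polyXaddC_K r _).
Qed.

(** A translation preserves the lexicographic leading coefficient, so the constant is 1. This turns
    (H1) into a true equality. *)
Lemma eq_upto_const_shift a b p : p != 0 ->
  eq_upto_const (shift a b p) p -> shift a b p = p.
Proof.
move=> p0 [c c0 e_p]; have := lead_coef_shift a b p.
rewrite e_p !lead_coefM !lead_coefC => /eqP.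
rewrite -[X in _ == X]mul1r (inj_eq (mulIf _)) ?lead_coef_eq0 // => /eqP ->.
by rewrite mul1r.
Qed.

Lemma shift_fixed_opp a b p : shift a b p = p -> shift (- a) (- b) p = p.
Proof. by move=> e_p; rewrite -{1}e_p shiftK. Qed.

Lemma shift_swapXY a b p : shift a b (swapXY p) = swapXY (shift b a p).
Proof.
apply: (bipoly_rmorphism_ext (f := shift a b \o swapXY)
  (g := swapXY \o shift b a)) => [k||] /=.
- by rewrite shiftC !swapXY_polyC !map_polyC /= shiftC.
- by rewrite swapXY_X shiftX shiftY (rmorphD swapXY) /= swapXY_X swapXY_polyC map_polyC.
- by rewrite swapXY_Y shiftX shiftY (rmorphD swapXY) /= swapXY_Y swapXY_polyC map_polyC.
Qed.

(* The involution i -> - i, j -> i + j, which conjugates the shift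
   (i, j) -> (i + 1, j - 1) into i -> i - 1. *)
Definition shear p : bipoly K := (map_poly poly_XaY p).[- 'X].

HB.instance Definition _ := GRing.RMorphism.copy (@poly_XaY K)
  (comp_poly ('X + 'Y) \o map_poly polyC).
Lemma shear_is_zmod_morphism : zmod_morphism shear.
Proof. by move=> p q; rewrite /shear rmorphB hornerD hornerN. Qed.

Lemma shear_is_monoid_morphism : monoid_morphism shear.
Proof. by split=> [|p q]; rewrite /shear ?rmorph1 ?hornerC // rmorphM hornerM. Qed.

HB.instance Definition _ := GRing.isZmodMorphism.Build _ _ shear shear_is_zmod_morphism.
HB.instance Definition _ := GRing.isMonoidMorphism.Build _ _ shear shear_is_monoid_morphism.

Lemma shearX : shear 'X = - 'X.
Proof. by rewrite /shear map_polyX hornerX. Qed.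

Lemma shear_polyC (q : {poly K}) : shear q%:P = poly_XaY q.
Proof. by rewrite /shear map_polyC hornerC. Qed.

Lemma shearY : shear 'Y = 'X + 'Y.
Proof. by rewrite shear_polyC /poly_XaY map_polyX comp_polyX. Qed.

Lemma shear_const (k : K) : shear k%:P%:P = k%:P%:P.
Proof. by rewrite shear_polyC /poly_XaY map_polyC comp_polyC. Qed.

Lemma shearK : involutive shear.
Proof.
apply: (bipoly_rmorphism_ext (f := shear \o shear) (g := idfun)) => [k||] /=.
- by rewrite !shear_const.
- by rewrite shearX rmorphN /= shearX opprK.
- by rewrite shearY rmorphD /= shearX shearY addKr.
Qed.

Lemma shear_shift p : shear (shift 1 (-1) p) = shift (-1) 0 (shear p).
Proof.
apply: (bipoly_rmorphism_ext (f := shear \o shift 1 (-1))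
  (g := shift (-1) 0 \o shear)) => [k||] /=.
- by rewrite shiftC !shear_const shiftC.
- rewrite shiftX shearX rmorphD rmorphN /= shearX shiftX shear_const.
  by rewrite mulrN1z mulr1z !polyCN; ring.
- rewrite shiftY shearY !rmorphD /= shearY shiftX shiftY shear_const.
  by rewrite mulrN1z mulr0z !polyC0; ring.
Qed.

Section CharacteristicZero.
Hypothesis charK0 : [pchar K] =i pred0.

(** By periodicity p - p(0, j) vanishes at every natural number i. These are pairwise distinct in
    characteristic zero, too many for a nonzero polynomial in i. *)
Lemma shift_fixed_i p : shift 1 0 p = p -> exists q : {poly K}, p = q%:P.
Proof.
move=> fix_p; exists p.[0]; apply/eqP; rewrite -subr_eq0; apply/negPn/negP => r0.
have p_nat n : p.[n%:R] = p.[0].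
  elim: n => // n IHn; rewrite -IHn -[in RHS]fix_p.
  rewrite /shift map_poly_id => [|x _]; last by rewrite addr0 comp_polyXr.
  by rewrite horner_comp !hornerE mulrS addrC.
have := max_poly_roots (rs := [seq n%:R | n <- iota 0 (size (p - p.[0]%:P))]) r0.
rewrite size_map size_iota ltnn => H; suff: false by []; apply: H.
  by apply/allP => _ /mapP[n _ ->]; rewrite /root !hornerE p_nat subrr.
rewrite map_inj_uniq ?iota_uniq // => m n.
have /pcharf0P natr0 := charK0.
have natrP0 (d : nat) : ((d%:R : {poly K}) == 0) = (d == 0%N).
  by rewrite -polyC_natr polyC_eq0 natr0.
wlog le_mn : m n / (m <= n)%N => [W e|].
  by case/orP: (leq_total m n) => le; [|symmetry]; apply: W.
move/eqP; rewrite eq_sym -subr_eq0 -natrB // natrP0 subn_eq0 => le_nm.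
by apply/eqP; rewrite eqn_leq le_mn.
Qed.

Lemma shift_fixed_j p : shift 0 1 p = p -> exists q : {poly K}, p = q^:P.
Proof.
move=> fix_p; have [|q e_q] := @shift_fixed_i (swapXY p).
  by rewrite shift_swapXY fix_p.
by exists q; rewrite -swapXY_polyC -e_q swapXYK.
Qed.

(** [shear p] is fixed by i -> i - 1, hence lies in K[j], which [shear] maps back to polynomials in
    i + j. *)
Lemma shift_fixed_ij p : shift 1 (-1) p = p -> exists q : {poly K}, p = poly_XaY q.
Proof.
move=> fix_p; have [|q e_q] := @shift_fixed_i (shear p).
  by rewrite -{1}fix_p shear_shift shift_comp subrr addr0 shift00.
by exists q; rewrite -shear_polyC -e_q shearK.
Qed.

End CharacteristicZero.

Lemma polyC2_unit (k : K) : k != 0 -> k%:P%:P \is a @GRing.unit (bipoly K).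
Proof.
move=> k0; rewrite poly_unitE size_polyC polyC_eq0 k0 coefC eqxx.
by rewrite poly_unitE size_polyC k0 coefC eqxx unitfE k0.
Qed.

(** A divisor of a polynomial in j has degree 0 in i, whereas c(i) and c(i+j) have the degree of c
    in i. Hence an irreducible divisor of q(j) lies neither in K[i] nor in K[i+j]. *)
Lemma dvd_polyC_const p (q : {poly K}) : q != 0 -> dvd p q%:P ->
  (exists c : {poly K}, p = c^:P) \/ (exists c : {poly K}, p = poly_XaY c) ->
  exists2 k : K, k != 0 & p = k%:P%:P.
Proof.
move=> q0 p_q; have qP0 : q%:P != 0 :> bipoly K by rewrite polyC_eq0.
have p0 := dvd_neq0 p_q qP0.
have sz_p : size p = 1%N.
  case: p_q => r e_q; have r0 : r != 0 by apply: contraNneq qP0 => r0; rewrite e_q r0 mul0r.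
  have := congr1 (fun x : bipoly K => size x) e_q; rewrite size_mul // size_polyC q0.
  move: r0 p0; rewrite -!size_poly_gt0.
  by case: (size r) => // m _; case: (size p) => // n _; rewrite addnS /=; case: m => //= [[]].
move=> IS_p; have [c [sz_c e_p]] : exists c : {poly K}, size c = 1%N /\ (p = c^:P \/ p = poly_XaY c).
  case: IS_p => -[c e_p]; exists c; move: sz_p;
    by rewrite e_p ?size_poly_XaY ?size_map_polyC; auto.
case/eqP/size_poly1P: sz_c => k k0 e_c; exists k => //.
by case: e_p => ->; rewrite e_c ?map_polyC // -shear_polyC shear_const.
Qed.

Lemma dvd_map_polyC_const p (q : {poly K}) : q != 0 -> dvd p q^:P ->
  (exists c : {poly K}, p = c%:P) \/ (exists c : {poly K}, p = poly_XaY c) ->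
  exists2 k : K, k != 0 & p = k%:P%:P.
Proof.
move=> q0 [r e_q] JS_p; have [|||k k0 e_p] := @dvd_polyC_const (swapXY p) q => //.
- by exists (swapXY r); rewrite -(rmorphM swapXY) /= -e_q swapXY_map_polyC.
- by case: JS_p => -[c ->]; [left|right]; exists c; rewrite ?swapXY_polyC ?swapXY_poly_XaY.
- by exists k => //; rewrite -[p]swapXYK e_p swapXY_polyC map_polyC.
Qed.

Definition factorial_bipoly := factorial_poly (factorial_poly (factorial_field K)).

Lemma is_gcd_exists (p q : bipoly K) : p != 0 -> exists d : bipoly K, is_gcd p q d.
Proof.
move=> p0; have [d [d_p d_q Hd]] := gcd_exists factorial_bipoly q p0.
have d0 := dvd_neq0 d_p p0.
pose k := lead_coef (lead_coef d); have k0 : k != 0 by rewrite !lead_coef_eq0.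
have e_d : d = k%:P%:P * (k^-1%:P%:P * d).
  by rewrite mulrA -!polyCM divff // mul1r.
have d'_d : dvd (k^-1%:P%:P * d) d by exists k%:P%:P.
exists (k^-1%:P%:P * d); split.
- by rewrite !lead_coefM !lead_coefC mulVf.
- exact: dvd_trans d'_d d_p.
- exact: dvd_trans d'_d d_q.
- by move=> e e_p e_q; apply: dvd_mull; apply: Hd.
Qed.

Lemma coprime2_irreducible (p q r : bipoly K) : coprime2 p q ->
  irreducible_elt r -> dvd r p -> dvd r q -> False.
Proof.
move=> [_ _ _ Hd] [_ Ur _] rp rq; case/negP: Ur.
exact: dvd_unit (Hd _ rp rq) (unitr1 _).
Qed.

End Shift.

(** * From the telescoping equation to a polynomial identity *)

Lemma rmorph_scaled_quotient (L : fieldType) (A : comAlgType L)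
    (E : {rmorphism A -> A}) (F : A) (f g f' g' t : L) :
  g != 0 -> g' != 0 -> E f%:A = f'%:A -> E g%:A = g'%:A -> E F = t *: F ->
  E ((f / g) *: F) = (f' / g' * t) *: F.
Proof.
move=> g0 g'0 E_f E_g E_F.
have : g%:A * ((f / g) *: F) = f%:A * F.
  by rewrite !mulr_algl scalerA mulrC divfK.
move/(congr1 E); rewrite !rmorphM /= E_f E_g E_F !mulr_algl => e.
by apply: (scalerI g'0); rewrite e !scalerA; congr (_ *: _); field.
Qed.

Section ClearedIdentity.
Variable R : idomainType.
Implicit Types D X Y f g : R.

(* [1 = (f1' X / (D g1') - f1 / g1) + (f2' Y / (D g2') - f2 / g2)] without its
   denominators, where [x'] stands for a shift of [x]. *)
Definition cleared_identity D X Y f1 f2 g1 g2 f1' f2' g1' g2' : Prop :=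
  D * (g1 * g2 * g1' * g2') =
    f1' * X * g1 * g2 * g2' - f1 * D * g2 * g1' * g2'
    + f2' * Y * g1 * g2 * g1' - f2 * D * g1 * g1' * g2'.

Lemma cleared_identity_sym D X Y f1 f2 g1 g2 f1' f2' g1' g2' :
  cleared_identity D X Y f1 f2 g1 g2 f1' f2' g1' g2' ->
  cleared_identity D Y X f2 f1 g2 g1 f2' f1' g2' g1'.
Proof.
move=> e; rewrite /cleared_identity.
have -> : D * (g2 * g1 * g2' * g1') = D * (g1 * g2 * g1' * g2') by ring.
by rewrite e; ring.
Qed.

(** Every term but f1' X g1 g2 g2' carries the factor g1'; the witness collects their cofactors. *)
Lemma cleared_identity_dvd_shift D X Y f1 f2 g1 g2 f1' f2' g1' g2' :
  cleared_identity D X Y f1 f2 g1 g2 f1' f2' g1' g2' ->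
  dvd g1' (f1' * (g1 * (g2 * g2')) * X).
Proof.
move=> e; exists (D * g1 * g2 * g2' + f1 * D * g2 * g2' - f2' * Y * g1 * g2
  + f2 * D * g1 * g2').
apply/eqP; rewrite -subr_eq0; move/eqP: e; rewrite eq_sym -subr_eq0.
by congr (_ == 0); ring.
Qed.

Lemma cleared_identity_dvd D X Y f1 f2 g1 g2 f1' f2' g1' g2' :
  cleared_identity D X Y f1 f2 g1 g2 f1' f2' g1' g2' ->
  dvd g1 (f1 * (g2 * (g1' * g2')) * D).
Proof.
move=> e; exists (f1' * X * g2 * g2' + f2' * Y * g2 * g1' - f2 * D * g1' * g2'
  - D * g2 * g1' * g2').
apply/eqP; rewrite -subr_eq0; move/eqP: e; rewrite -subr_eq0.
by congr (_ == 0); ring.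
Qed.

End ClearedIdentity.

(** The quotients r1 / (s1 u) and r2 / (s2 u) are put over the common denominator s1 s2 u, which
    gives the numerators r1 s2 and r2 s1. *)
Lemma clear_denominators (L : fieldType) (r1 s1 r2 s2 u f1 g1 f2 g2 f1' g1' f2' g2' : L) :
  s1 != 0 -> s2 != 0 -> u != 0 -> g1 != 0 -> g2 != 0 -> g1' != 0 -> g2' != 0 ->
  1 = (f1' / g1' * (r1 / (s1 * u)) - f1 / g1) + (f2' / g2' * (r2 / (s2 * u)) - f2 / g2) ->
  cleared_identity (s1 * s2 * u) (r1 * s2) (r2 * s1) f1 f2 g1 g2 f1' f2' g1' g2'.
Proof.
move=> s10 s20 u0 g10 g20 g1'0 g2'0 e; rewrite /cleared_identity -[LHS]mulr1 e; field.
by rewrite g20 g2'0 s20 g10 u0 s10.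
Qed.

Lemma scaler_inj_nz (L : fieldType) (V : lmodType L) (x : V) (k l : L) :
  x != 0 -> k *: x = l *: x -> k = l.
Proof.
move=> x0 /eqP; rewrite -subr_eq0 -scalerBl scaler_eq0 (negPf x0) orbF subr_eq0.
by move/eqP.
Qed.

Section TelescopingIdentity.
Variables (K : fieldType) (A : comAlgType (birat K)).

Lemma telescoping_identity (Ei Ej : {rmorphism A -> A}) F
    (r1 s1 r2 s2 f1 g1 f2 g2 u s1' s2' : bipoly K) :
  shift_operators Ei Ej -> F != 0 ->
  s1 != 0 -> s2 != 0 -> g1 != 0 -> g2 != 0 ->
  shift_quotient Ei F (r1%:F / s1%:F) -> shift_quotient Ej F (r2%:F / s2%:F) ->
  F = Delta Ei ((f1%:F / g1%:F) *: F) + Delta Ej ((f2%:F / g2%:F) *: F) ->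
  s1 = s1' * u -> s2 = s2' * u ->
  cleared_identity (s1' * s2' * u) (r1 * s2') (r2 * s1') f1 f2 g1 g2
    (shift 1 0 f1) (shift 0 1 f2) (shift 1 0 g1) (shift 0 1 g2).
Proof.
move=> [_ _ _ EiA EjA] F0 s10 s20 g10 g20 ratio1 ratio2 + es1 es2.
have sg10 : (shift 1 0 g1)%:F != 0 by rewrite tofrac_eq0 shift_eq0.
have sg20 : (shift 0 1 g2)%:F != 0 by rewrite tofrac_eq0 shift_eq0.
rewrite -tofrac_eq0 in g10; rewrite -tofrac_eq0 in g20.
rewrite /Delta (rmorph_scaled_quotient g10 sg10 (EiA f1) (EiA g1) ratio1).
rewrite (rmorph_scaled_quotient g20 sg20 (EjA f2) (EjA g2) ratio2).
rewrite -!scalerBl -scalerDl => e.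
(* F need not be invertible, but a nonzero vector over the field K(i,j) determines its scalar. *)
have {}e : 1 = (shift 1 0 f1)%:F / (shift 1 0 g1)%:F * (r1%:F / s1%:F) - f1%:F / g1%:F
   + ((shift 0 1 f2)%:F / (shift 0 1 g2)%:F * (r2%:F / s2%:F) - f2%:F / g2%:F).
  by apply: (scaler_inj_nz F0); rewrite scale1r.
rewrite /cleared_identity; apply/eqP; rewrite -tofrac_eq; apply/eqP.
rewrite !(tofracD, tofracN, tofracM).
move: s10 s20 e; rewrite es1 es2 !mulf_eq0 !negb_or => /andP[s10 u0] /andP[s20 _].
rewrite -tofrac_eq0 in s10; rewrite -tofrac_eq0 in s20; rewrite -tofrac_eq0 in u0.
rewrite !tofracM => e.
exact (clear_denominators s10 s20 u0 g10 g20 sg10 sg20 e).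
Qed.

End TelescopingIdentity.

(** * Irreducible powers dividing a denominator of the certificate *)

Section PrimePowers.
Variable K : fieldType.
Variables (a b c d : int) (D X Y f1 f2 g1 g2 g1' g2' v : bipoly K).
Let box (h : int) := h \in [:: -1; 0; 1].
(** [sigma] and [tau] stand for the two unit shifts in either order, so that one argument serves
    both g1 and g2. *)
Let sigma := @shift K a b.
Let tau := @shift K c d.
Hypotheses (box_s : box a /\ box b) (box_t : box (- c) /\ box (- d))
  (box_Ns : box (- a) /\ box (- b)) (box_st : box (a - c) /\ box (b - d)).
Hypothesis identity :
  cleared_identity D X Y f1 f2 g1 g2 (sigma f1) (tau f2) (sigma g1) (tau g2).
Hypothesis fixed_factor : forall g : bipoly K, g = g1 \/ g = g2 ->
  forall (p : bipoly K) (h1 h2 : int), box h1 -> box h2 ->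
  irreducible_elt p -> dvd p g -> dvd (shift h1 h2 p) g -> shift h1 h2 p = p.
Hypotheses (cop_fg1 : coprime2 f1 g1) (cop_g1'v : coprime2 g1' v).
Hypotheses (def_g1 : g1 = g1' * v) (def_g2 : g2 = g2' * v).
Hypothesis cop_shift : forall h1 h2 : int, box h1 -> box h2 ->
  coprime2 (shift h1 h2 g1') g2'.

Let prime (p x y : bipoly K) : irreducible_elt p -> dvd p (x * y) -> dvd p x \/ dvd p y.
Proof. by case: (factorial_bipoly K) => _ _; apply. Qed.

Let v_g1 p : dvd p v -> dvd p g1.
Proof. by rewrite def_g1; apply: dvd_mull. Qed.

Let v_g2 p : dvd p v -> dvd p g2.
Proof. by rewrite def_g2; apply: dvd_mull. Qed.

Let g1'_g1 p : dvd p g1' -> dvd p g1.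
Proof. by rewrite def_g1; apply: dvd_mulr. Qed.

(** By (H3) the shifted factor cannot divide g2', so it would divide v and thus g1; (H1) then makes
    it equal to p, against (H2). *)
Lemma unshared_factor_shift p h1 h2 : irreducible_elt p -> dvd p g1' ->
  box h1 -> box h2 -> ~ dvd (shift h1 h2 p) g2.
Proof.
move=> irr_p p_g1' bh1 bh2; have irr_q := irreducible_shift h1 h2 irr_p.
rewrite def_g2 => /(prime irr_q)[q_g2'|q_v].
  by apply: (coprime2_irreducible (cop_shift bh1 bh2) irr_q) => //; apply: shift_dvd.
have e_p : shift h1 h2 p = p.
  by apply: (fixed_factor (g := g1)); auto.
by rewrite e_p in q_v; apply: coprime2_irreducible cop_g1'v irr_p p_g1' q_v.
Qed.

(** Modulo [sigma g1], the prime [sigma p] is excluded from every factor of the surviving term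
    except X; the result is then shifted back. *)
Lemma numerator_prime_power p m : irreducible_elt p -> (0 < m)%N ->
  dvd (p ^+ m) g1 -> sigma p <> p ->
  dvd p g1' \/ dvd p v /\ shift (a - c) (b - d) p <> p ->
  dvd (p ^+ m) (shift (- a) (- b) X).
Proof.
move=> irr_p m0 pm_g1 Nfix_p kind_p.
have [[ba bb] [bst1 bst2]] := (box_s, box_st).
have p_g1 := dvd_expn m0 pm_g1.
have irr_q : irreducible_elt (sigma p) := irreducible_shift a b irr_p.
suff: dvd (sigma p ^+ m) X.
  by move/(shift_dvd (- a) (- b)); rewrite rmorphXn /= /sigma shiftK.
have Nq_g1 : ~ dvd (sigma p) g1.
  by move=> q_g1; apply: Nfix_p; apply: (fixed_factor (g := g1)); auto.
have Nq_g2 : ~ dvd (sigma p) g2.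
  case: kind_p => [p_g1'|[p_v _] q_g2]; first exact: unshared_factor_shift.
  by apply: Nfix_p; apply: (fixed_factor (g := g2)); auto.
(* Undoing [tau] puts the shift of p by (a - c, b - d) into g2, hence the second condition when p
   divides v. *)
have Nq_tg2 : ~ dvd (sigma p) (tau g2).
  move/dvd_shiftr; rewrite /sigma shift_comp ![- _ + _]addrC.
  case: kind_p => [p_g1'|[p_v Nfix_st] q_g2]; first exact: unshared_factor_shift.
  by apply: Nfix_st; apply: (fixed_factor (g := g2)); auto.
have Nq_sf1 : ~ dvd (sigma p) (sigma f1).
  move/dvd_shiftr; rewrite /sigma shiftK => p_f1.
  exact: coprime2_irreducible cop_fg1 irr_p p_f1 p_g1.
apply: (prime_expn_coprime (factorial_bipoly K) (a := sigma f1 * (g1 * (g2 * tau g2))) irr_q).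
  by do !case/(prime irr_q) => //.
have : dvd (sigma p ^+ m) (sigma g1).
  by rewrite -(rmorphXn (shift a b)); apply: shift_dvd.
by move/dvd_trans; apply; apply: cleared_identity_dvd_shift identity.
Qed.

(** The same argument modulo g1 itself. Here p must divide g1', because a factor of v divides g2,
    which occurs in the surviving term. *)
Lemma denominator_prime_power p m : irreducible_elt p -> (0 < m)%N ->
  dvd (p ^+ m) g1 -> sigma p <> p -> dvd p g1' -> dvd (p ^+ m) D.
Proof.
move=> irr_p m0 pm_g1 Nfix_p p_g1'.
have [[ba bb] [bt1 bt2]] := (box_Ns, box_t).
have Np_g2 : ~ dvd p g2 by rewrite -[p]shift00; apply: unshared_factor_shift.
have Np_tg2 : ~ dvd p (tau g2) by move/dvd_shiftr; apply: unshared_factor_shift.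
have Np_sg1 : ~ dvd p (sigma g1).
  move/dvd_shiftr => q_g1; apply: Nfix_p.
  have e : shift (- a) (- b) p = p by apply: (fixed_factor (g := g1)); auto.
  by have := shift_fixed_opp e; rewrite !opprK.
have Np_f1 : ~ dvd p f1.
  by move=> p_f1; apply: coprime2_irreducible cop_fg1 irr_p p_f1 (g1'_g1 p_g1').
apply: (prime_expn_coprime (factorial_bipoly K) (a := f1 * (g2 * (sigma g1 * tau g2))) irr_p).
  by do !case/(prime irr_p) => //.
exact: dvd_trans pm_g1 (cleared_identity_dvd identity).
Qed.

End PrimePowers.

(** * The factorization of the two denominators *)

Unset Implicit Arguments.
Set Strict Implicit.

Theorem theorem1 (K : fieldType) (charK0 : [pchar K] =i pred0)
  (A : comAlgType (birat K)) (Ei Ej : {rmorphism A -> A})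
  (shiftE : shift_operators Ei Ej)
  (F : A) (hypF : hypergeometric Ei Ej F)
  (r1 s1 r2 s2 : bipoly K)
  (s1_neq0 : s1 != 0) (s2_neq0 : s2 != 0)
  (cop_rs1 : coprime2 r1 s1) (cop_rs2 : coprime2 r2 s2)
  (ratio1 : shift_quotient Ei F (r1%:F / s1%:F))
  (ratio2 : shift_quotient Ej F (r2%:F / s2%:F))
  (R1 R2 : birat K) (f1 g1 f2 g2 : bipoly K)
  (g1_neq0 : g1 != 0) (g2_neq0 : g2 != 0)
  (cop_fg1 : coprime2 f1 g1) (cop_fg2 : coprime2 f2 g2)
  (defR1 : R1 = f1%:F / g1%:F) (defR2 : R2 = f2%:F / g2%:F)
  (telescoping : F = Delta Ei (R1 *: F) + Delta Ej (R2 *: F))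
  (u v s1' s2' g1' g2' : bipoly K)
  (defu : is_gcd s1 s2 u) (defv : is_gcd g1 g2 v)
  (defs1' : s1 = s1' * u) (defs2' : s2 = s2' * u)
  (defg1' : g1 = g1' * v) (defg2' : g2 = g2' * v)
  (H1 : forall g : bipoly K, g = g1 \/ g = g2 ->
    forall (p : bipoly K) (h1 h2 : int),
      h1 \in [:: -1; 0; 1] -> h2 \in [:: -1; 0; 1] ->
      irreducible_factor p g -> irreducible_factor (shift h1 h2 p) g ->
      eq_upto_const (shift h1 h2 p) p)
  (H2 : coprime2 g1' v /\ coprime2 g2' v)
  (H3 : forall h1 h2 : int,
      h1 \in [:: -1; 0; 1] -> h2 \in [:: -1; 0; 1] ->
      coprime2 (shift h1 h2 g1') g2') :
  exists (v1 w1 v2 u1 v3 : {poly K}) (v4 u2 w2 : bipoly K),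
    [/\ g1 = v1^:P * v2%:P * poly_XaY v3 * v4 * u1%:P * u2
      & g2 = v1^:P * v2%:P * poly_XaY v3 * v4 * w1^:P * w2]
    /\
    [/\ divides v1^:P (shift (-1) 0 r1 * shift (-1) 0 s2'),
        divides v2%:P (shift 0 (-1) r2 * shift 0 (-1) s1'),
        exists2 d, is_gcd (shift (-1) 0 r1 * shift (-1) 0 s2')
                          (shift 0 (-1) r2 * shift 0 (-1) s1') d & divides v4 d,
        exists2 d, is_gcd (s1 * s2')
                          (shift (-1) 0 r1 * shift (-1) 0 s2') d & divides u2 d
      & exists2 d, is_gcd (s2 * s1')
                          (shift 0 (-1) r2 * shift 0 (-1) s1') d & divides w2 d].
Proof.
have [injEi _ _ _ _] := shiftE; have [F0 _ _] := hypF.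
rewrite defR1 defR2 in telescoping.
have identity1 := telescoping_identity shiftE F0 s1_neq0 s2_neq0 g1_neq0 g2_neq0
  ratio1 ratio2 telescoping defs1' defs2'.
set D := s1' * s2' * u in identity1.
(* The two forms of D are those in the bounds on [u2] and [w2]. *)
have D1 : D = s1 * s2' by rewrite /D defs1'; ring.
have D2 : D = s2 * s1' by rewrite /D defs2'; ring.
have fixed g : g = g1 \/ g = g2 -> forall (p : bipoly K) (h1 h2 : int),
    h1 \in [:: -1; 0; 1] -> h2 \in [:: -1; 0; 1] ->
    irreducible_elt p -> dvd p g -> dvd (shift h1 h2 p) g -> shift h1 h2 p = p.
  move=> eg p h1 h2 bh1 bh2 irr_p pg qg; have [p0 _ _] := irr_p.
  apply: (eq_upto_const_shift p0); apply: (H1 g) => //.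
  by split=> //; apply: irreducible_shift.
have fixed' g : g = g2 \/ g = g1 -> forall (p : bipoly K) (h1 h2 : int),
    h1 \in [:: -1; 0; 1] -> h2 \in [:: -1; 0; 1] ->
    irreducible_elt p -> dvd p g -> dvd (shift h1 h2 p) g -> shift h1 h2 p = p.
  by case=> eg; apply: fixed; auto.
(* (H3) with g1' and g2' exchanged, by shifting a common divisor back by (h1, h2). *)
have H3' h1 h2 : h1 \in [:: -1; 0; 1] -> h2 \in [:: -1; 0; 1] ->
    coprime2 (shift h1 h2 g2') g1'.
  move=> bh1 bh2; have [] := H3 (- h1) (- h2).
  - by move: bh1; rewrite !inE => /or3P[] /eqP ->.
  - by move: bh2; rewrite !inE => /or3P[] /eqP ->.
  move=> lc1 _ _ Hd; split=> // [||e e_g2 e_g1]; try exact: unit_dvd (unitr1 _).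
  have := Hd (shift (- h1) (- h2) e).
  case; [exact: shift_dvd|by move/(shift_dvd (- h1) (- h2)): e_g2; rewrite shiftK|].
  move=> k e_k; exists (shift h1 h2 k).
  by rewrite -[e in RHS](shiftVK h1 h2) -rmorphM /= -e_k rmorph1.
have identity2 := cleared_identity_sym identity1.
have [cop_g1'v cop_g2'v] := H2.
pose X1 := shift (-1) 0 r1 * shift (-1) 0 s2'.
pose X2 := shift 0 (-1) r2 * shift 0 (-1) s1'.
have eX1 : X1 = shift (- 1) (- 0) (r1 * s2') by rewrite rmorphM oppr0.
have eX2 : X2 = shift (- 0) (- 1) (r2 * s1') by rewrite rmorphM oppr0.
have num1 p m := @numerator_prime_power K 1 0 0 1 D (r1 * s2') (r2 * s1') f1 f2 g1 g2
  g1' g2' v (conj isT isT) (conj isT isT) identity1 fixed cop_fg1 cop_g1'v defg1' defg2' H3 p m.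
have num2 p m := @numerator_prime_power K 0 1 1 0 D (r2 * s1') (r1 * s2') f2 f1 g2 g1
  g2' g1' v (conj isT isT) (conj isT isT) identity2 fixed' cop_fg2 cop_g2'v defg2' defg1' H3' p m.
have den1 p m := @denominator_prime_power K 1 0 0 1 D (r1 * s2') (r2 * s1') f1 f2 g1 g2
  g1' g2' v (conj isT isT) (conj isT isT) identity1 fixed cop_fg1 cop_g1'v defg1' defg2' H3 p m.
have den2 p m := @denominator_prime_power K 0 1 1 0 D (r2 * s1') (r1 * s2') f2 f1 g2 g1
  g2' g1' v (conj isT isT) (conj isT isT) identity2 fixed' cop_fg2 cop_g2'v defg2' defg1' H3' p m.
rewrite -[shift _ _ _]eX1 in num1.
rewrite -[shift _ _ _]eX2 in num2.
have fac := factorial_bipoly K.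
have nz (x y : bipoly K) : x * y != 0 -> x != 0 /\ y != 0.
  by rewrite mulf_eq0 negb_or => /andP[].
have [g1'0 v0] : g1' != 0 /\ v != 0 by apply: nz; rewrite -defg1'.
have [g2'0 _] : g2' != 0 /\ v != 0 by apply: nz; rewrite -defg2'.
pose in_i (p : bipoly K) := exists q : {poly K}, p = q^:P.
pose in_j (p : bipoly K) := exists q : {poly K}, p = q%:P.
pose in_ij (p : bipoly K) := exists q : {poly K}, p = poly_XaY q.
have in_i1 : in_i 1 by exists 1; rewrite rmorph1.
have in_j1 : in_j 1 by exists 1.
have in_ij1 : in_ij 1 by exists 1; rewrite rmorph1.
have in_iM x y : in_i x -> in_i y -> in_i (x * y).
  by move=> [p ->] [q ->]; exists (p * q); rewrite rmorphM.
have in_jM x y : in_j x -> in_j y -> in_j (x * y).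
  by move=> [p ->] [q ->]; exists (p * q); rewrite polyCM.
have in_ijM x y : in_ij x -> in_ij y -> in_ij (x * y).
  by move=> [p ->] [q ->]; exists (p * q); rewrite rmorphM.
(* v is split as [x1 * x2 * x3 * v4] with parts in K[i], K[j], K[i+j] and a rest without nonunit
   divisor of these kinds. From g1' the part in K[j] is removed, from g2' the part in K[i]. *)
have [x1 [y1 [ev [v1 ex1] Ny1]]] := split_off fac v0 in_i1 in_iM.
have [x10 y10] : x1 != 0 /\ y1 != 0 by apply: nz; rewrite -ev.
have [x2 [y2 [ey1 [v2 ex2] Ny2]]] := split_off fac y10 in_j1 in_jM.
have [x20 y20] : x2 != 0 /\ y2 != 0 by apply: nz; rewrite -ey1.
have [x3 [v4 [ey2 [v3 ex3] Nv4]]] := split_off fac y20 in_ij1 in_ijM.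
have [_ v40] : x3 != 0 /\ v4 != 0 by apply: nz; rewrite -ey2.
have [z1 [u2 [eg1' [u1 ez1] Nu2]]] := split_off fac g1'0 in_j1 in_jM.
have [_ u20] : z1 != 0 /\ u2 != 0 by apply: nz; rewrite -eg1'.
have [z2 [w2 [eg2' [w1 ez2] Nw2]]] := split_off fac g2'0 in_i1 in_iM.
have [_ w20] : z2 != 0 /\ w2 != 0 by apply: nz; rewrite -eg2'.
have x1_v : dvd x1 v by exists y1; rewrite mulrC.
have y1_v : dvd y1 v by exists x1.
have x2_y1 : dvd x2 y1 by exists y2; rewrite mulrC.
have y2_y1 : dvd y2 y1 by exists x2.
have v4_y2 : dvd v4 y2 by exists x3.
have v4_y1 := dvd_trans v4_y2 y2_y1.
have u2_g1' : dvd u2 g1' by exists z1.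
have w2_g2' : dvd w2 g2' by exists z2.
have g1'_g1 : dvd g1' g1 by exists v; rewrite mulrC.
have g2'_g2 : dvd g2' g2 by exists v; rewrite mulrC.
have v_g1 : dvd v g1 by exists g1'.
have v_g2 : dvd v g2 by exists g2'.
have fix_i (p : bipoly K) : ~ in_j p -> shift 1 0 p <> p.
  by move=> Np /(shift_fixed_i charK0).
have fix_j (p : bipoly K) : ~ in_i p -> shift 0 1 p <> p.
  by move=> Np /(shift_fixed_j charK0).
have fix_ij (p : bipoly K) : ~ in_ij p -> shift 1 (-1) p <> p.
  by move=> Np /(shift_fixed_ij charK0).
have fix_ji (p : bipoly K) : ~ in_ij p -> shift (-1) 1 p <> p.
  by move=> Np /shift_fixed_opp; rewrite opprK => /(shift_fixed_ij charK0).
have v1_X1 : dvd x1 X1.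
  apply: (dvd_prime_powers fac x10) => p m irr_p m0 pm_x1.
  have p_x1 := dvd_expn m0 pm_x1.
  have v10 : v1 != 0 by apply: contraNneq x10 => v10; rewrite ex1 v10 rmorph0.
  (* An irreducible divisor of v1(i) lying in K[j] or K[i+j] would be constant; so both shifts in
     [num1] move p. *)
  have N_unit : ~ (in_j p \/ in_ij p).
    move=> H; have [|k k0 ep] := dvd_map_polyC_const v10 _ H; first by rewrite -ex1.
    by case: irr_p => _ + _; rewrite ep polyC2_unit.
  apply: num1 => //.
  - exact: dvd_trans (dvd_trans pm_x1 x1_v) v_g1.
  - by apply: fix_i => H; apply: N_unit; left.
  - right; split; first exact: dvd_trans p_x1 x1_v.
    by apply: fix_ij => H; apply: N_unit; right.
have v2_X2 : dvd x2 X2.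
  apply: (dvd_prime_powers fac x20) => p m irr_p m0 pm_x2.
  have p_x2 := dvd_expn m0 pm_x2.
  have x2_v := dvd_trans x2_y1 y1_v.
  have v20 : v2 != 0 by apply: contraNneq x20 => v20; rewrite ex2 v20.
  have N_unit : ~ (in_i p \/ in_ij p).
    move=> H; have [|k k0 ep] := dvd_polyC_const v20 _ H; first by rewrite -ex2.
    by case: irr_p => _ + _; rewrite ep polyC2_unit.
  apply: num2 => //.
  - exact: dvd_trans (dvd_trans pm_x2 x2_v) v_g2.
  - by apply: fix_j => H; apply: N_unit; left.
  - right; split; first exact: dvd_trans p_x2 x2_v.
    by apply: fix_ji => H; apply: N_unit; right.
have v4_v := dvd_trans v4_y1 y1_v.
have v4_kind p : irreducible_elt p -> dvd p v4 -> [/\ ~ in_i p, ~ in_j p & ~ in_ij p].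
  move=> [_ /negP Up _] p_v4; split=> H; apply: Up.
  - by apply: Ny1 H; apply: dvd_trans p_v4 v4_y1.
  - by apply: Ny2 H; apply: dvd_trans p_v4 v4_y2.
  - exact: Nv4 H.
have v4_X1 : dvd v4 X1.
  apply: (dvd_prime_powers fac v40) => p m irr_p m0 pm_v4.
  have p_v4 := dvd_expn m0 pm_v4.
  have [Ni Nj Nij] := v4_kind p irr_p p_v4.
  apply: num1 => //; [exact: dvd_trans (dvd_trans pm_v4 v4_v) v_g1|exact: fix_i|].
  by right; split; [apply: dvd_trans p_v4 v4_v|apply: fix_ij].
have v4_X2 : dvd v4 X2.
  apply: (dvd_prime_powers fac v40) => p m irr_p m0 pm_v4.
  have p_v4 := dvd_expn m0 pm_v4.
  have [Ni Nj Nij] := v4_kind p irr_p p_v4.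
  apply: num2 => //; [exact: dvd_trans (dvd_trans pm_v4 v4_v) v_g2|exact: fix_j|].
  by right; split; [apply: dvd_trans p_v4 v4_v|apply: fix_ji].
(* No irreducible factor of [u2] lies in K[j], so each is moved by i -> i + 1. *)
have u2_D_X1 : dvd u2 D /\ dvd u2 X1.
  split; apply: (dvd_prime_powers fac u20) => p m irr_p m0 pm_u2;
    have p_u2 := dvd_expn m0 pm_u2;
    have p_g1' := dvd_trans p_u2 u2_g1';
    have pm_g1 := dvd_trans (dvd_trans pm_u2 u2_g1') g1'_g1;
    have Nfix : shift 1 0 p <> p by
      (apply: fix_i => H; case: irr_p => _ /negP + _; apply; apply: Nu2 H).
  - exact: den1.
  - by apply: num1 => //; left.
have w2_D_X2 : dvd w2 D /\ dvd w2 X2.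
  split; apply: (dvd_prime_powers fac w20) => p m irr_p m0 pm_w2;
    have p_w2 := dvd_expn m0 pm_w2;
    have p_g2' := dvd_trans p_w2 w2_g2';
    have pm_g2 := dvd_trans (dvd_trans pm_w2 w2_g2') g2'_g2;
    have Nfix : shift 0 1 p <> p by
      (apply: fix_j => H; case: irr_p => _ /negP + _; apply; apply: Nw2 H).
  - exact: den2.
  - by apply: num2 => //; left.
have [s1'0 u0] : s1' != 0 /\ u != 0 by apply: nz; rewrite -defs1'.
have [s2'0 _] : s2' != 0 /\ u != 0 by apply: nz; rewrite -defs2'.
(* If r1 = 0, then Ei F = 0, against injectivity. This makes [X1] nonzero, which yields the gcd of
   [X1] and [X2]. *)
have r10 : r1 != 0.
  apply: contraNneq F0 => r10; apply/eqP/injEi.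
  by rewrite ratio1 r10 tofrac0 mul0r scale0r rmorph0.
have X10 : X1 != 0 by rewrite mulf_neq0 ?shift_eq0.
have [d4 gcd4] := is_gcd_exists X2 X10.
have [d5 gcd5] := is_gcd_exists X1 (mulf_neq0 s1_neq0 s2'0).
have [d6 gcd6] := is_gcd_exists X2 (mulf_neq0 s2_neq0 s1'0).
rewrite D1 in u2_D_X1; rewrite D2 in w2_D_X2.
exists v1, w1, v2, u1, v3, v4, u2, w2; rewrite -ex1 -ex2 -ex3 -ez1 -ez2.
split; first by rewrite defg1' defg2' ev ey1 ey2 eg1' eg2'; split; ring.
split=> //.
- by exists d4 => //; case: gcd4 => _ _ _; apply.
- by exists d5 => //; case: gcd5 => _ _ _; case: u2_D_X1 => ? ?; apply.
- by exists d6 => //; case: gcd6 => _ _ _; case: w2_D_X2 => ? ?; apply.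
Qed.
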